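(* Let $G$ be a non-elementary word-hyperbolic group and let $\mathcal{F}$ be a countable collection of quotients of $G$, each with infinite kernel. Then $G$ contains a proper, infinitely generated subgroup $K$ which surjects onto every quotient in the family $\mathcal{F}$ (that is, for every quotient $G/N$ in $\mathcal{F}$, the restriction to $K$ of the quotient map $G\to G/N$ is surjective). In particular, $G$ contains a proper subgroup $K$ which is not engulfed.
   Context: A finitely generated group $G$ is word-hyperbolic if, with the word metric of a finite generating set, it is a $\delta$-hyperbolic space for some $\delta\ge 0$. It is elementary if it is finite or contains a finite index infinite cyclic subgroup, and non-elementary otherwise. ''Infinitely generated'' means not finitely generated. A subgroup $H\le G$ is engulfed if $H$ is contained in a proper finite index subgroup of $G$. *)

(* Defs.v *)
From HB Require Import structures.
From mathcomp Require Import all_boot all_order all_algebra.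
From mathcomp Require Import boolp classical_sets functions cardinality reals.

Set Implicit Arguments.
Unset Strict Implicit.
Unset Printing Implicit Defensive.

Import Order.TTheory GRing.Theory Num.Theory.

Local Open Scope classical_set_scope.

Section Subgroups.
Local Open Scope group_scope.
Variable G : groupType.
Implicit Types (H K N L A : set G) (g : G).

Definition is_subgroup H : Prop := group_closed (mem H).

Definition is_proper_subgroup H : Prop := is_subgroup H /\ H <> [set: G].

Definition is_normal_subgroup N : Prop :=
  is_subgroup N /\ forall x g, N x -> N (x ^ g).

Definition generated A : set G := smallest is_subgroup A.

Definition finitely_generated H : Prop :=
  exists2 A : set G, finite_set A & generated A = H.

Definition infinitely_generated H : Prop := ~ finitely_generated H.

Definition quotient_map N g : set G := [set g * x | x in N].

(* The underlying set of G / N, as a set of cosets; also used when N is not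
   normal, for the index of N. *)
Definition quotient_set N : set (set G) := range (quotient_map N).

Definition finite_index H : Prop := finite_set (quotient_set H).

Definition surjects_onto_quotient K N : Prop :=
  set_surj K (quotient_set N) (quotient_map N).

Definition infinite_cyclic H : Prop :=
  infinite_set H /\ exists g, H = generated [set g].

Definition engulfed H : Prop :=
  exists L, [/\ is_proper_subgroup L, finite_index L & H `<=` L].

End Subgroups.

Definition elementary (G : groupType) : Prop :=
  finite_set [set: G] \/
  exists H : set G,
    [/\ is_subgroup H, finite_index H & infinite_cyclic H].

Section Hyperbolicity.
Local Open Scope ring_scope.
Variable R : realType.

Definition gromov_product (T : Type) (d : T -> T -> R) (w x y : T) : R :=
  (d x w + d y w - d x y) / 2.

Definition delta_hyperbolic (T : Type) (d : T -> T -> R) (delta : R) : Prop :=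
  forall w x y z : T,
    Num.min (gromov_product d w x z) (gromov_product d w z y) - delta
      <= gromov_product d w x y.

Definition words_for (G : groupType) (S : set G) (g : G) : set (seq G) :=
  [set s | (forall a, a \in s -> S a \/ S (a^-1)%g) /\ (\prod_(a <- s) a)%g = g].

(* When S generates G this is the infimum of a nonempty set of naturals, hence
   a minimum. *)
Definition word_length (G : groupType) (S : set G) (g : G) : R :=
  inf [set (size s)%:R | s in words_for S g].

Definition word_metric (G : groupType) (S : set G) (g h : G) : R :=
  word_length S (g^-1 * h)%g.

Definition word_hyperbolic (G : groupType) : Prop :=
  exists S : set G,
    [/\ finite_set S, generated S = [set: G] &
      exists2 delta : R, 0 <= delta & delta_hyperbolic (word_metric S) delta].

End Hyperbolicity.

(* Main.v *)
Require Import Defs.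
From mathcomp Require Import all_boot all_order all_algebra.
From mathcomp Require Import boolp classical_sets functions cardinality reals.
From mathcomp Require Import filter finmap zify lra.

Set Implicit Arguments.
Unset Strict Implicit.
Unset Printing Implicit Defensive.

Local Open Scope classical_set_scope.
Local Open Scope group_scope.

(** A group with finitely many generators is not a directed union of proper
   subgroups, so a subgroup that is not finitely generated is proper.  It is
   therefore enough to choose one element k_j in each of the countably many
   cosets g N (with N in the given family) such that k_j never lies in the
   subgroup generated by the k_i with i < j: the subgroup generated by all k_j
   then meets every coset and is an increasing union that does not stabilize
   ([infinitely_generated_range], [prodense_subgroup]).  The k_j are found by
   ping-pong ([pingpong_free]) in the action of G on itself.

   The ping-pong sets are shadows: the shadow of a is the set of y whose
   geodesic from 1 passes near a.  For k = a n b^-1, the condition that k maps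
   the complement of the shadow of b into the shadow of a only says that n and
   n^-1 do not point in the directions of a^-1 and b^-1.  Such an n exists in
   every coset of N: take any long element n0 of the coset and replace it by
   s n0 t^-1, where s and t are two elements of N chosen in a finite family
   whose members point, along with their inverses, in different directions
   ([transversal_element]).  The same kind of family, used to branch again and
   again, yields infinitely many disjoint shadows ([disjoint_shadows]).

   So everything rests on one such diverging family, first in G
   ([diverging_exists]) and from there, by conjugating a long element of N, in N
   ([diverging_normal]).  A point xi of the boundary of G is a nonprincipal
   ultrafilter on G: its elements have ever longer common prefixes because balls
   are finite.  If the stabilizer of xi had finite index, the Busemann function
   at xi would be a quasimorphism with finite fibres on it, which forces G to
   be elementary ([elementary_of_boundary_stabilizer]).  Otherwise xi has
   infinitely many translates g xi, and in the same way some f moves the limit of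
   the y^-1, where y tends to xi.  For y far out, the elements (g y) f (g y)^-1 and their inverses point
   towards the distinct g xi.

   For the last assertion, a subgroup of finite index contains all n-th powers
   for some n > 0.  The subgroups generated by the n-th powers form a countable
   family of normal subgroups, which are infinite because ping-pong produces an
   element of infinite order.  A subgroup that surjects onto the quotients by
   them lies in no proper subgroup of finite index. *)

(** * Subgroups and cosets *)

Section Subgroup.
Variables (G : groupType) (H : set G).
Hypothesis sH : is_subgroup H.

Lemma subgroup1 : H 1.
Proof. by case: sH => + _; rewrite in_setE. Qed.

Lemma subgroupV x : H x -> H x^-1.
Proof.
move=> Hx; have := group_closedV sH; move/(_ x).
by rewrite !in_setE; apply.
Qed.

Lemma subgroupM x y : H x -> H y -> H (x * y).
Proof.
move=> Hx Hy; have := group_closedM sH; move/(_ x y).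
by rewrite !in_setE; apply.
Qed.

End Subgroup.

Lemma is_subgroupI (G : groupType) (H : set G) :
  H 1 -> (forall x y, H x -> H y -> H (x * y)) -> (forall x, H x -> H x^-1) ->
  is_subgroup H.
Proof.
move=> H1 HM HV; split; first by rewrite in_setE.
by move=> x y; rewrite !in_setE => Hx Hy; apply: HM => //; apply: HV.
Qed.

Lemma quotient_mapP (G : groupType) (N : set G) x y : is_subgroup N ->
  quotient_map N x = quotient_map N y <-> N (x^-1 * y).
Proof.
move=> sN; split=> [xy|Nxy].
  have : quotient_map N y y by exists 1; rewrite ?mulg1 //; exact: subgroup1.
  by rewrite -xy => -[n Nn <-]; rewrite mulKg.
apply/seteqP; split=> _ [n Nn <-].
  exists (y^-1 * x * n); last by rewrite -mulgA mulVKg.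
  apply: (subgroupM sN) => //; rewrite -[y^-1 * x]invgK invgM invgK.
  exact: (subgroupV sN).
exists (x^-1 * y * n); last by rewrite -mulgA mulVKg.
exact: (subgroupM sN).
Qed.

Lemma generated_subgroup (G : groupType) (A : set G) : is_subgroup (generated A).
Proof.
apply: is_subgroupI => [H [sH _]|x y Ax Ay H [sH AH]|x Ax H [sH AH]].
- exact: subgroup1.
- by apply: (subgroupM sH); [apply: Ax|apply: Ay].
- by apply: (subgroupV sH); apply: Ax.
Qed.

Lemma generated_sub (G : groupType) (A H : set G) : is_subgroup H ->
  A `<=` H -> generated A `<=` H.
Proof. exact: smallest_sub. Qed.

Lemma sub_generated (G : groupType) (A : set G) : A `<=` generated A.
Proof. exact: sub_gen_smallest. Qed.

Lemma subgroupX (G : groupType) (H : set G) x n : is_subgroup H -> H x -> H (x ^+ n).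
Proof.
move=> sH Hx; elim: n => [|n IHn]; first by rewrite expg0; apply: subgroup1.
by rewrite expgS; apply: subgroupM.
Qed.

Lemma infinite_range (T : Type) (f : nat -> T) :
  injective f -> infinite_set (range f).
Proof.
move=> fI; rewrite (eq_finite_set (inj_card_eq (in2W fI))).
exact: infinite_nat.
Qed.

Lemma expg_inj (G : groupType) (g : G) :
  (forall n, g ^+ n.+1 <> 1) -> injective (fun n => g ^+ n).
Proof.
move=> gn.
have aux m n : m <= n -> g ^+ m = g ^+ n -> m = n.
  move=> mn; rewrite -(subnKC mn) expgnDr.
  case: (n - m) => [|k]; first by rewrite addn0.
  by rewrite -{1}[g ^+ m]mulg1 => /mulgI/esym/gn.
move=> m n /= mn; case: (leqP m n) => [|/ltnW] h; first exact: aux.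
by apply/esym/aux.
Qed.

(** Pairwise distinct cosets are recorded through representatives, in the form
   in which translates of a boundary point will be compared. *)
Lemma many_cosets (G : groupType) (H : set G) n : is_subgroup H -> ~ finite_index H ->
  exists2 s : seq G, size s = n & pairwise (fun x y => `[< ~ H (x^-1 * y) >]) s.
Proof.
move=> sH infH; elim: n => [|n [s sn ps]]; first by exists nil.
suff [x xs] : exists x, forall y, y \in s -> ~ H (x^-1 * y).
  exists (x :: s); rewrite /= ?sn // ps andbT.
  by apply/allP => y /xs ?; apply/asboolP.
apply: contrapT => /forallNP nox; apply: infH.
apply: (@sub_finite_set _ _ (quotient_map H @` [set` s])); last exact: finite_image.
move=> _ [x _ <-]; have /existsNP[y /not_implyP[ys /contrapT Hxy]] := nox x.
by exists y => //; apply/esym/(quotient_mapP _ _ sH).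
Qed.

Lemma outside_infinite_index (G : groupType) (H : set G) :
  is_subgroup H -> ~ finite_index H -> exists g, ~ H g.
Proof.
move=> sH /(many_cosets 2 sH)[[|x [|y []]] //= _ /andP[/andP[/asboolP Hxy _] _]].
by exists (x^-1 * y).
Qed.

Lemma finite_index_infinite (G : groupType) (H : set G) : infinite_set [set: G] ->
  is_subgroup H -> finite_index H -> infinite_set H.
Proof.
move=> infG sH finH; apply: contra_not infG => finHs.
apply: (@sub_finite_set _ _ (\bigcup_(C in quotient_set H) C)).
  move=> x _; exists (quotient_map H x); first by exists x.
  by exists 1; [exact: subgroup1|rewrite mulg1].
apply: bigcup_finite => // _ [x _ <-]; exact: finite_image.
Qed.

(** Among x^0, ..., x^d two powers lie in one of the d cosets, so x^m is in L for
   some 0 < m <= d; d! is a multiple of all these m. *)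
Lemma finite_index_exponent (G : groupType) (L : set G) : is_subgroup L ->
  finite_index L -> exists2 n, 0 < n & forall x, L (x ^+ n).
Proof.
move=> sL finL.
have /finite_seqP[s Ls] := finL.
exists (size s)`!; first exact: fact_gt0.
move=> x; pose C i := quotient_map L (x ^+ i).
have : ~~ uniq (map C (iota 0 (size s).+1)).
  apply/negP => /uniq_leq_size/(_ (_ : {subset _ <= s})) le_s.
  suff /le_s : {subset map C (iota 0 (size s).+1) <= s}.
    by rewrite size_map size_iota ltnn.
  move=> _ /mapP[i _ ->]; have : quotient_set L (C i) by exists (x ^+ i).
  by rewrite Ls.
move/(uniqPn set0) => [i [j []]]; rewrite size_map size_iota => ij js.
rewrite !(nth_map 0) ?size_iota ?(ltn_trans ij) // !nth_iota ?(ltn_trans ij) //.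
rewrite !add0n => /(quotient_mapP _ _ sL).
rewrite -(subnKC (ltnW ij)) expgnDr mulKg => Lx.
have /dvdnP[m ->] : j - i %| (size s)`! by apply: dvdn_fact; lia.
by rewrite mulnC expgnA; apply: (subgroupX _ sL).
Qed.

Lemma power_subgroup_normal (G : groupType) n :
  is_normal_subgroup (generated [set (x : G) ^+ n | x in [set: G]]).
Proof.
set P := generated _; have sP : is_subgroup P := @generated_subgroup G _.
split=> // x g Px.
apply: (@generated_sub G _ [set x | P (x ^ g)] _ _ x Px).
  apply: is_subgroupI => [|y z Py Pz|y Py] /=.
  - by rewrite conj1g; apply: (subgroup1 sP).
  - by rewrite conjMg; apply: (subgroupM sP).
  - by rewrite conjVg; apply: (subgroupV sP).
by move=> _ [y _ <-] /=; rewrite conjXg; apply: sub_generated; exists (y ^ g).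
Qed.

(** A finite generating set would already lie in the subgroup generated by
   finitely many of the k_i. *)
Lemma infinitely_generated_range (G : groupType) (k : nat -> G) :
  (forall n, ~ generated (k @` `I_n) (k n)) ->
  infinitely_generated (generated (range k)).
Proof.
move=> kn [A /finite_seqP[s ->] Ak].
have mono m n : m <= n -> generated (k @` `I_m) `<=` generated (k @` `I_n).
  move=> mn; apply: generated_sub; first exact: generated_subgroup.
  move=> _ [i /= im <-]; apply: sub_generated; exists i => //=.
  exact: leq_trans im mn.
have cover x : generated (range k) x -> exists n, generated (k @` `I_n) x.
  apply: (@generated_sub G (range k) [set x | exists n, generated (k @` `I_n) x]).
    apply: is_subgroupI => [|y z [m ym] [n zn]|y [n yn]].
    - by exists 0; apply: (subgroup1 (@generated_subgroup G _)).
    - exists (maxn m n); apply: (subgroupM (@generated_subgroup G _)).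
        by apply: mono ym; rewrite leq_maxl.
      by apply: mono zn; rewrite leq_maxr.
    - by exists n; apply: (subgroupV (@generated_subgroup G _)).
  by move=> _ [i _ <-]; exists i.+1; apply: sub_generated; exists i => /=.
have [n sn] : exists n, forall x, x \in s -> generated (k @` `I_n) x.
  have : forall x, x \in s -> generated (range k) x.
    by move=> x xs; rewrite -Ak; apply: sub_generated.
  elim: s {Ak} => [|x s IHs] sk; first by exists 0.
  have [m xm] := cover x (sk x (mem_head x s)).
  have [y ys|n sn] := IHs; first by apply: sk; rewrite inE ys orbT.
  exists (maxn m n) => y; rewrite inE => /orP[/eqP ->|/sn].
    by apply: mono xm; rewrite leq_maxl.
  by apply: mono; rewrite leq_maxr.
apply: (kn n).
apply: (@generated_sub G [set` s] _ (@generated_subgroup G _)) => //.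
by rewrite Ak; apply: sub_generated; exists n.
Qed.

(** * Ping-pong *)

(** The sets [Z false i] and [Z true i] attract k_i and its inverse.  Freeness is
   proved without normal forms of words: [reduced] describes the elements
   obtained from 1 by applying letters outside their repelling sets, and this
   set is stable under all letters. *)
Section PingPong.
Variables (G : groupType) (Z : bool -> nat -> set G) (k : nat -> G).
Hypothesis Zdisj : forall b c i j x, Z b i x -> Z c j x -> b = c /\ i = j.
Hypothesis Z1 : forall b i, ~ Z b i 1.
Hypothesis Zk : forall i x, ~ Z true i x -> Z false i (k i * x).

Definition letter (b : bool) i : G := if b then (k i)^-1 else k i.

(** The condition on k_i^-1 is the contrapositive of the one on k_i. *)
Lemma letter_pingpong b i x : ~ Z (~~ b) i x -> Z b i (letter b i * x).
Proof.
case: b => /=; last exact: Zk.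
by apply: contra_notP => /Zk; rewrite mulVKg.
Qed.

Inductive reduced (I : set nat) : G -> Prop :=
| Reduced1 : reduced I 1
| ReducedM b i x : I i -> reduced I x -> ~ Z (~~ b) i x ->
    reduced I (letter b i * x).

(** If x lies in the repelling set of the letter, then by disjointness the last
   letter applied to reach x was its inverse, and the two cancel. *)
Lemma reduced_letter (I : set nat) b i x :
  I i -> reduced I x -> reduced I (letter b i * x).
Proof.
move=> Ii rx; have [|] := pselect (Z (~~ b) i x); last exact: ReducedM.
case: rx => [/Z1 //|c j y Ij ry /[dup] nz /letter_pingpong Zc Zb].
have [cb ->] := Zdisj Zc Zb; rewrite cb /letter.
by case: (b) => /=; rewrite ?mulKg ?mulVKg.
Qed.

Lemma generated_reduced (I : set nat) x : generated (k @` I) x -> reduced I x.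
Proof.
pose H : set G := [set g | forall y, reduced I y ->
  reduced I (g * y) /\ reduced I (g^-1 * y)].
have sH : is_subgroup H.
  apply: is_subgroupI => [y ry|g h Hg Hh y ry|g Hg y ry].
  - by rewrite invg1 mul1g.
  - split; first by rewrite -mulgA; apply Hg; apply Hh.
    by rewrite invgM -mulgA; apply Hh; apply Hg.
  - by rewrite invgK; split; apply Hg.
have HI : k @` I `<=` H.
  move=> _ [i Ii <-] y ry; split; first exact: (@reduced_letter I false).
  exact: (@reduced_letter I true).
move=> /(generated_sub sH HI)/(_ 1 (Reduced1 I))[+ _].
by rewrite mulg1.
Qed.

Lemma pingpong_free (I : set nat) j : ~ I j -> ~ generated (k @` I) (k j).
Proof.
move=> nIj /generated_reduced rk; have Zkj : Z false j (k j).
  by rewrite -[k j]mulg1; apply: Zk; apply: Z1.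
case: rk Zkj => [/Z1 //|b i x Ii _ /letter_pingpong Zi Zj].
by have [_ ij] := Zdisj Zi Zj; apply: nIj; rewrite -ij.
Qed.

Lemma pingpong_infinite_order i : injective (fun n => k i ^+ n).
Proof.
apply: expg_inj => n kn; suff : Z false i (k i ^+ n.+1) by rewrite kn => /Z1.
elim: n {kn} => [|n IHn]; rewrite expgS; apply: Zk; first exact: Z1.
by move=> /(Zdisj IHn)[].
Qed.

End PingPong.

(** * Ultrafilters *)

Lemma ultra_fmap (T S : Type) (f : T -> S) (U : set_system T) :
  UltraFilter U -> UltraFilter (fmap f U).
Proof.
move=> UU; split=> [|V PV UV]; first exact: fmap_proper_filter.
apply/seteqP; split; last exact: UV.
move=> A VA; have [//|nA] := in_ultra_setVsetC (f @^-1` A) UU.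
have /UV VnA : fmap f U (~` A) by [].
have [x [Ax nAx]] := filter_ex (filterI VA VnA).
by case: nAx.
Qed.

(** An ultrafilter picks one class of any finite partition. *)
Lemma ultra_seq (T : Type) (S : eqType) (f : T -> S) (s : seq S)
    (U : set_system T) : UltraFilter U ->
  U [set x | f x \in s] -> exists a, U [set x | f x = a].
Proof.
move=> UU; elim: s => [Us|a s IHs Us].
  by have [x] := filter_ex Us.
have [Ua|Una] := in_ultra_setVsetC [set x | f x = a] UU; first by exists a.
apply: IHs; apply: filterS (filterI Us Una) => x [/=].
by rewrite inE => /orP[/eqP|].
Qed.

Lemma size_filter2 (T : eqType) (a b : pred T) (s : seq T) :
  (count a s <= 1%N) -> (count b s <= 1%N) ->
  (size s <= size [seq x : T <- s | ~~ a x && ~~ b x] + 2).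
Proof.
move=> a1 b1; have := count_predUI a b s.
have := count_predC (predU a b) s.
rewrite size_filter.
rewrite (@eq_count _ (predC (predU a b)) (fun x : T => ~~ a x && ~~ b x)).
  by lia.
by move=> x /=; rewrite negb_or.
Qed.

(** * Gromov products *)

(** All lengths are natural numbers, and Gromov products are doubled to stay so:
   the four-point condition is the one for twice the product based at 1, and D
   bounds twice the hyperbolicity constant.  That prefixes of every length exist
   is the only trace of geodesics. *)
Record hyperbolic_length (G : groupType) (len : G -> nat) (D : nat) : Prop :=
  HyperbolicLength {
    len1 : len 1 = 0;
    lenV : forall x, len x^-1 = len x;
    lenM : forall x y, (len (x * y) <= len x + len y);
    len_ball : forall n, exists s : seq G, forall x, (len x <= n) -> x \in s;
    len_prefix : forall x n, (n <= len x) ->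
      exists2 p, len p = n & (len (p^-1 * x) = len x - n);
    len_four_point : forall x y z,
      (minn (len x + len z - len (x^-1 * z)) (len z + len y - len (z^-1 * y))
        <= len x + len y - len (x^-1 * y) + D) }.

Section HyperbolicGroup.
Variables (G : groupType) (len : G -> nat) (D : nat).
Hypothesis hypG : hyperbolic_length len D.
Implicit Types (x y z g h : G).

Definition gp x y : nat := (len x + len y - len (x^-1 * y)).

(* Products of G reach lia through several structure paths; naming the lengths
   and Gromov products up to conversion makes equal ones syntactically equal. *)
Ltac glia :=
  repeat match goal with
  | H : is_true _ |- _ => revert H
  | H : @eq nat _ _ |- _ => revert H
  | H : @eq int _ _ |- _ => revert H
  end;
  repeat match goal with
  | |- context [gp ?x ?y] => let a := fresh "a" in set a := (gp x y); clearbody a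
  end;
  repeat match goal with
  | |- context [len ?x] => let a := fresh "a" in set a := (len x); clearbody a
  end; lia.

Lemma gpE x y : (gp x y + len (x^-1 * y) = len x + len y).
Proof.
have := lenM hypG x^-1 y; rewrite (lenV hypG) /gp; glia.
Qed.

Lemma gpC x y : gp x y = gp y x.
Proof.
have := gpE x y; have := gpE y x.
have := lenV hypG (x^-1 * y); rewrite invgM invgK; glia.
Qed.

Lemma gp_four_point x z y : (minn (gp x z) (gp z y) <= gp x y + D).
Proof. exact: (len_four_point hypG). Qed.

Lemma gp1 x : gp x 1 = 0%N.
Proof. by have := gpE x 1; rewrite mulg1 (lenV hypG) (len1 hypG); glia. Qed.

Lemma gp_le_len x y : (gp x y <= (len x).*2).
Proof.
have := gpE x y; have := lenM hypG x (x^-1 * y); rewrite mulVKg; glia.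
Qed.

(** The identity behind ping-pong: x y starts along x as far as y does not start
   along x^-1. *)
Lemma gp_mull x y : (gp x (x * y) + gp x^-1 y = (len x).*2).
Proof.
have := gpE x (x * y); have := gpE x^-1 y.
by rewrite mulKg invgK (lenV hypG); glia.
Qed.

Lemma len_mull g x : (len (g * x) + gp g^-1 x = len g + len x).
Proof. by have := gpE g^-1 x; rewrite invgK (lenV hypG); glia. Qed.

Lemma len_mul3 x y z : (len (x * y * z) <= len x + len y + len z).
Proof. by have := lenM hypG (x * y) z; have := lenM hypG x y; glia. Qed.

Lemma gp_translate g x y :
  (gp (g * x) (g * y) + len x + len y = gp x y + len (g * x) + len (g * y)).
Proof.
have := gpE (g * x) (g * y); have := gpE x y.
by rewrite invgM -mulgA mulKg; glia.
Qed.

Lemma gp_translate_le g x y : (gp (g * x) (g * y) <= gp x y + (len g).*2).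
Proof.
have := gp_translate g x y; have := lenM hypG g x; have := lenM hypG g y; glia.
Qed.

Lemma gp_mulr_le x h y : (gp (x * h) y <= gp x y + (len h).*2).
Proof.
have := gpE (x * h) y; have := gpE x y; have := lenM hypG x h.
have := lenM hypG h ((x * h)^-1 * y).
by rewrite invgM -!mulgA mulVKg; glia.
Qed.

Lemma infinite_long (A : set G) n : infinite_set A -> exists2 x, A x & n < len x.
Proof.
move=> infA; apply: contrapT => shortA; apply: infA.
have [s Bs] := len_ball hypG n.
apply: (@sub_finite_set _ _ [set` s]) => // x Ax; apply: Bs.
by rewrite leqNgt; apply/negP => xn; apply: shortA; exists x.
Qed.

Lemma len_bounded (s : seq G) : exists B, forall x, x \in s -> len x <= B.
Proof.
exists (\max_(t <- s) len t) => t ts.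
by rewrite (big_rem t) //= leq_maxl.
Qed.

(** * Points at infinity *)

(** A boundary point is an ultrafilter whose members leave every ball. *)
Section BoundaryPoint.
Variable U : set_system G.
Hypothesis UU : UltraFilter U.
Hypothesis U_infty : forall n, U [set x | n <= len x].

(** Limits along U are equal exactly when their Gromov product is infinite, so
   this is the stabilizer of the limit of U. *)
Definition boundary_stabilizer : set G :=
  [set g | forall n, U [set x | n <= gp (g * x) x]].

Lemma boundary_stabilizer_subgroup : is_subgroup boundary_stabilizer.
Proof.
apply: is_subgroupI => [n|g h Ug Uh n|g Ug n].
- apply: filterS (U_infty n) => x /=; rewrite mul1g => nx.
  by have := gpE x x; rewrite mulVg (len1 hypG); glia.
- apply: filterS (filterI (Ug (n + D)) (Uh (n + D + (len g).*2))) => x [/= gx hx].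
  have := gp_four_point (g * h * x) (g * x) x.
  have := gp_translate_le g^-1 (g * h * x) (g * x).
  by rewrite -!mulgA !mulKg (lenV hypG); glia.
- apply: filterS (Ug (n + (len g).*2)) => x /= gx.
  have := gp_translate_le g (g^-1 * x) x.
  by rewrite mulVKg (gpC x); glia.
Qed.

Lemma boundary_stabilizerN g : ~ boundary_stabilizer g ->
  exists n, U [set x | gp (g * x) x <= n].
Proof.
move=> /existsNP[n Un]; exists n.
have [//|] := in_ultra_setVsetC [set x | n <= gp (g * x) x] UU.
apply: filterS => x /= /negP; rewrite -ltnNge; exact: ltnW.
Qed.

(** A point at distance n from 1 on a geodesic ray towards the limit of U: the
   prefixes of length n lie in a finite ball, so one of them is common to
   U-almost all x. *)
Lemma ray_point n : exists2 p, len p = n & U [set x | gp p x = n.*2].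
Proof.
have /choice[f fP] : forall x, exists p, n <= len x ->
    len p = n /\ len (p^-1 * x) = len x - n.
  move=> x; case: (leqP n (len x)) => [nx|_]; last by exists 1.
  by have [p lp px] := len_prefix hypG nx; exists p.
have [s sP] := len_ball hypG n.
have [p Up] : exists p, U [set x | f x = p].
  apply: (ultra_seq (s := s)); apply: filterS (U_infty n) => x /= nx.
  by apply: sP; have [-> _] := fP x nx.
have [x0 [/= fx0 nx0]] :=
  filter_ex (filterI Up (U_infty n)).
have [lp _] := fP x0 nx0; rewrite fx0 in lp.
exists p => //; apply: filterS (filterI Up (U_infty n)) => x [/= fx nx].
have [_] := fP x nx; rewrite fx => px.
by have := gpE p x; glia.
Qed.

(** The Busemann function is the limit along U of |g x| - |x|, which takes
   finitely many integer values, hence is constant U-almost everywhere. *)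
Lemma busemann_exists : exists b : G -> int,
  forall g, U [set x | Posz (len (g * x)) = (Posz (len x) + b g)%R].
Proof.
suff /choice[b bP] : forall g, exists b : int,
    U [set x | Posz (len (g * x)) = (Posz (len x) + b)%R] by exists b.
move=> g.
have [m Um] : exists m, U [set x | len (g * x) + len g - len x = m].
  apply: (ultra_seq (s := iota 0 (len g).*2.+1)).
  apply: filterS (@filterT _ U _) => x _; rewrite /mkset mem_iota.
  by have := lenM hypG g x; glia.
exists (Posz m - Posz (len g))%R; apply: filterS Um => x /= Um.
have := lenM hypG g^-1 (g * x); rewrite mulKg (lenV hypG).
glia.
Qed.

Variable b : G -> int.
Hypothesis bP : forall g, U [set x | Posz (len (g * x)) = (Posz (len x) + b g)%R].

Ltac blia :=
  repeat match goal with
  | H : is_true _ |- _ => revert H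
  | H : @eq int _ _ |- _ => revert H
  end;
  repeat match goal with
  | |- context [b ?x] => let a := fresh "a" in set a := (b x); clearbody a
  end; lia.

Lemma busemann1 : b 1 = 0%R.
Proof. by have [x /=] := filter_ex (bP 1); rewrite mul1g; glia. Qed.

(** As h x and x have the same limit, |g z| - |z| has nearly the same value at
   z = h x and at z = x. *)
Lemma busemannM g h : boundary_stabilizer h ->
  (b (g * h)%g <= b g + b h + Posz D)%R /\ (b g + b h - Posz D <= b (g * h)%g)%R.
Proof.
move=> Uh.
have [x /= [[[Ux bh] bg] bgh]] := filter_ex
  (filterI (filterI (filterI (Uh ((len g).*2 + D).+1) (bP h)) (bP g)) (bP (g * h))).
have := len_mull g (h * x); have := len_mull g x.
have := gp_le_len g^-1 (h * x); have := gp_le_len g^-1 x.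
have := gp_four_point g^-1 (h * x) x.
have := gp_four_point g^-1 x (h * x).
rewrite !(gpC x) (lenV hypG) mulgA; glia.
Qed.

(** Elements with bounded Busemann value move a point p far along the ray by a
   bounded amount, so p^-1 g p stays in a fixed ball, whose cardinal does not
   depend on the number of elements considered. *)
Lemma busemann_fibre (m : nat) :
  finite_set [set g | boundary_stabilizer g /\ (`|b g| <= m)].
Proof.
apply: contrapT => infA.
have [S SP] := len_ball hypG (m.*2 + m + (D.*2 + D.*2)).
have [B BA] := @infinite_set_fset _ _ (size S).+1 infA.
apply/negP; rewrite -leqNgt.
have [R0 HR0] := len_bounded (enum_fset B).
(* beyond distance R0, the elements of B see p and the limit of U alike *)
have [p lp Up] := ray_point (R0 + D + m).
rewrite -(size_map (fun g => p^-1 * (g * p)) (enum_fset B)); apply: uniq_leq_size.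
  rewrite map_inj_uniq; first exact: fset_uniq.
  by move=> g h /mulgI /mulIg.
move=> _ /mapP[g gB ->]; apply: SP.
have [Ug bg] := BA g gB; have lg := HR0 g gB.
have [x /= [[Upx Ux] bx]] := filter_ex
  (filterI (filterI Up (Ug (R0 + D + m).*2)) (bP g)).
have := gpE p (g * p).
have := len_mull g p; have := len_mull g x.
have := gp_le_len g^-1 x; have := gp_le_len g^-1 p.
have := gp_four_point g^-1 p x.
have := gp_four_point g^-1 x p.
have := gp_translate g p x.
have := gp_four_point (g * p) (g * x) p.
have := gp_four_point (g * x) x p.
rewrite !(gpC _ p) (lenV hypG).
glia.
Qed.

(** Since the fibres are finite, |b| is unbounded; b g^-1 is nearly - b g. *)
Lemma busemann_large (m : nat) : infinite_set boundary_stabilizer ->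
  exists2 g, boundary_stabilizer g & (Posz m < b g)%R.
Proof.
move=> infU; apply: contrapT => small; apply: infU.
apply: sub_finite_set (busemann_fibre (m + D)) => g Ug; split => //.
rewrite leqNgt; apply/negP => bg; apply: small.
have UgV := subgroupV boundary_stabilizer_subgroup Ug.
have := busemannM g UgV; rewrite mulgV busemann1 => -[h1 h2].
have [|] := boolP (Posz m < b g)%R; first by exists g.
by exists g^-1 => //; blia.
Qed.

Lemma infinite_order_busemann g : boundary_stabilizer g -> (Posz D < b g)%R ->
  injective (fun n => g ^+ n).
Proof.
move=> Ug bg; apply: expg_inj => n gn.
suff : (0 < b (g ^+ n.+1))%R by rewrite gn busemann1.
elim: n {gn} => [|n IHn]; first by rewrite expg1; blia.
by have [] := busemannM (g ^+ n.+1) Ug; rewrite -expgSr; blia.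
Qed.

(** Multiplying by g or g^-1 moves the Busemann value by roughly b g, so it can
   be brought into a bounded window: <g> times a finite fibre is everything. *)
Lemma boundary_stabilizer_factor g x : boundary_stabilizer g -> (Posz D.*2 < b g)%R ->
  boundary_stabilizer x ->
  exists f z, [/\ boundary_stabilizer f, `|b f| <= `|b g| + D.*2,
    generated [set g] z & x = f * z].
Proof.
move=> Ug bg.
have gz := @sub_generated G [set g] g erefl.
have sg := @generated_subgroup G [set g].
elim: {x}_.+1 {-2}x (ltnSn `|b x|) => // n IHn x xn Ux.
have [small|large] := leqP `|b x| (`|b g| + D.*2).
  by exists x, 1; split; rewrite ?mulg1 //; apply: subgroup1.
have UgV := subgroupV boundary_stabilizer_subgroup Ug.
have [bV1 bV2] := busemannM g UgV; rewrite mulgV busemann1 in bV1 bV2.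
have [pos|neg] := boolP (0 <= b x)%R.
  have [b1 b2] := busemannM x UgV.
  have [||f [z [Uf bf zg xgz]]] := IHn (x * g^-1).
  - by blia.
  - exact: (subgroupM boundary_stabilizer_subgroup).
  exists f, (z * g); split => //; first exact: (subgroupM sg).
  by rewrite mulgA -xgz mulgVK.
have [b1 b2] := busemannM x Ug.
have [||f [z [Uf bf zg xgz]]] := IHn (x * g).
- by blia.
- exact: (subgroupM boundary_stabilizer_subgroup).
exists f, (z * g^-1); split => //.
  by apply: (subgroupM sg) => //; apply: (subgroupV sg).
by rewrite mulgA -xgz mulgK.
Qed.

End BoundaryPoint.

(** By [boundary_stabilizer_factor], the cyclic group of an element with large
   Busemann value has finite index in the stabilizer, hence in G. *)
Lemma elementary_of_boundary_stabilizer (U : set_system G) :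
  UltraFilter U -> (forall n, U [set x | n <= len x]) ->
  infinite_set [set: G] -> finite_index (boundary_stabilizer U) -> elementary G.
Proof.
move=> UU Uoo infG finU; right.
have sU := boundary_stabilizer_subgroup UU Uoo.
have infU := finite_index_infinite infG sU finU.
have [b bP] := busemann_exists UU.
have [g Ug bg] := busemann_large UU Uoo bP D.*2 infU.
exists (generated [set g]); split; first exact: generated_subgroup.
- have /choice[rep repP] : forall C, exists x, quotient_set (boundary_stabilizer U) C ->
      quotient_map (boundary_stabilizer U) x = C.
    move=> C; have [[x _ xC]|nC] := pselect (quotient_set (boundary_stabilizer U) C).
      by exists x.
    by exists 1 => /nC.
  apply: (@sub_finite_set _ _ [set quotient_map (generated [set g]) (x * f) |
      x in rep @` quotient_set (boundary_stabilizer U) &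
      f in [set f | boundary_stabilizer U f /\ `|b f| <= `|b g| + D.*2]]).
    move=> _ [x _ <-].
    have Cx : quotient_set (boundary_stabilizer U) (quotient_map (boundary_stabilizer U) x).
      by exists x.
    have /(quotient_mapP _ _ sU) Ux := repP _ Cx.
    have [f [z [Uf bf zg xfz]]] := boundary_stabilizer_factor UU Uoo bP Ug bg Ux.
    exists (rep (quotient_map (boundary_stabilizer U) x)).
      by exists (quotient_map (boundary_stabilizer U) x).
    exists f; first by [].
    apply/quotient_mapP; first exact: generated_subgroup.
    by rewrite invgM -mulgA xfz mulKg.
  apply: finite_image2; first exact: finite_image.
  exact: busemann_fibre.
- split; last by exists g.
  have ig := infinite_order_busemann UU bP Ug.
  apply: (@sub_infinite_set _ (range (fun n => g ^+ n))).
    move=> _ [n _ <-]; apply: (subgroupX _ (@generated_subgroup G [set g])).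
    exact: sub_generated.
  by apply: infinite_range; apply: ig; lia.
Qed.

(** * Diverging families *)

(** The elements of s point in different directions, and so do their inverses:
   they part from each other by distance q / 2, while they have length at
   least L. *)
Definition diverging q L (s : seq G) : bool :=
  pairwise (fun x y => (gp x y <= q) && (gp x^-1 y^-1 <= q)) s
  && all (fun x => L <= len x) s.

(** A direction z cannot be close to two directions that diverge. *)
Lemma count_aligned (f : G -> G) q z s :
  pairwise (fun x y => gp (f x) (f y) <= q) s ->
  (count (fun x => q + D < gp z (f x)) s <= 1%N).
Proof.
elim: s => //= x s IHs /andP[/allP xs /IHs {}IHs].
case: (ltnP (q + D) (gp z (f x))) => zx //=.
suff -> : count (fun y => q + D < gp z (f y)) s = 0 by [].
apply/eqP; rewrite -leqn0 leqNgt -has_count; apply/hasPn => y /xs xy.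
rewrite -leqNgt leqNgt; apply/negP => zy.
by have := gp_four_point (f x) z (f y); rewrite gpC; glia.
Qed.

Lemma diverging_count q L s z : diverging q L s ->
  (count (fun x => q + D < gp z x) s <= 1%N) /\
  (count (fun x => q + D < gp z x^-1) s <= 1%N).
Proof.
case/andP => ps _; split.
  apply: (count_aligned (f := id)).
  by apply: sub_pairwise ps => x y /andP[].
apply: (count_aligned (f := fun x => x^-1)).
by apply: sub_pairwise ps => x y /andP[].
Qed.

Lemma ultrafilter_at_infinity : infinite_set [set: G] ->
  exists2 U : set_system G, UltraFilter U & forall n, U [set x | n <= len x].
Proof.
move=> infG.
have FF : ProperFilter (filter_from setT (fun n => [set x | n <= len x])).
  apply: filter_from_proper; last first.
    move=> n _; have [x _ nx] := infinite_long n infG.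
    by exists x => /=; exact: ltnW.
  apply: filter_fromT_filter; first by exists 0.
  move=> m n; exists (maxn m n) => x /=; rewrite geq_max => /andP[? ?]; by split.
have [U [UU FU]] := ultraFilterLemma FF.
by exists U => // n; apply: FU; exists n.
Qed.

(** Distinct translates of the limit of U have finite Gromov products, bounded
   along U, and finitely many of them have a common bound. *)
Lemma diverging_translates (U : set_system G) s : UltraFilter U ->
  pairwise (fun x y => `[< ~ boundary_stabilizer U (x^-1 * y) >]) s ->
  exists R, U [set x | pairwise (fun g h => gp (g * x) (h * x) <= R) s].
Proof.
move=> UU; elim: s => [_|g s IHs /= /andP[gs /IHs[R1 UR1]]].
  by exists 0; apply: filterS (@filterT _ U _) => x _.
suff [R2 UR2] : exists R, U [set x | all (fun h => gp (g * x) (h * x) <= R) s].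
  exists (maxn R1 R2); apply: filterS (filterI UR1 UR2) => x [/= h1 h2].
  apply/andP; split.
    by apply: sub_all h2 => h; rewrite leq_max orbC => ->.
  by apply: sub_pairwise h1 => h k; rewrite leq_max => ->.
elim: s gs {IHs UR1} => [_|h s IHs /= /andP[/asboolP gh /IHs[R UR]]].
  by exists 0; apply: filterS (@filterT _ U _) => x _.
have [n Un] := boundary_stabilizerN UU gh.
exists (maxn R (n + (len g).*2)); apply: filterS (filterI Un UR) => x [/= hn hR].
apply/andP; split; last by apply: sub_all hR => k; rewrite leq_max => ->.
have := gp_translate_le g (g^-1 * h * x) x; rewrite !mulgA mulgV mul1g.
by rewrite (gpC (h * x)); glia.
Qed.

(** With y far out along U, f outside the stabilizer of the limit of the y^-1,
   and g in distinct cosets of the stabilizer of the limit of U, the elements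
   t g = (g y) f (g y)^-1 follow g y almost to its end, and so do their inverses.
   They part where the translates by g of the limit part, independently of y,
   so their length can be made large compared with q. *)
Lemma diverging_exists : infinite_set [set: G] -> ~ elementary G ->
  exists q s, diverging q (q.*2 + (D.*2 + D.*2)).+1 s /\ 4 < size s.
Proof.
move=> infG nelG.
have [U UU Uoo] := ultrafilter_at_infinity infG.
have VV := ultra_fmap (fun x : G => x^-1) UU.
have Voo n : fmap (fun x : G => x^-1) U [set x | n <= len x].
  change (U [set x | n <= len x^-1]).
  by apply: filterS (Uoo n) => x /=; rewrite (lenV hypG).
have Uinf : ~ finite_index (boundary_stabilizer U).
  by move=> h; apply: nelG; apply: elementary_of_boundary_stabilizer h.
have [f Vf] : exists f, ~ boundary_stabilizer (fmap (fun x : G => x^-1) U) f.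
  apply: (outside_infinite_index (boundary_stabilizer_subgroup VV Voo)).
  by move=> h; apply: nelG; apply: elementary_of_boundary_stabilizer h.
have [Rf VRf] := boundary_stabilizerN VV Vf.
have URf : U [set y | gp (f * y^-1) y^-1 <= Rf] := VRf.
have [s ss ps] := many_cosets 5 (boundary_stabilizer_subgroup UU Uoo) Uinf.
have [R UR] := diverging_translates UU ps.
have [B HB] := len_bounded s.
pose q := R + D.*2; pose K := Rf + (B.*2 + B.*2) + (len f).*2.
have [y [/= [yf ypw] ly]] := filter_ex (filterI (filterI URf UR)
  (Uoo (q.*2 + q + (D.*2 + D.*2) + K + B).+1)).
pose t g := (g * y) * f * (g * y)^-1.
(* K bounds twice the cancellation of g y against f (g y)^-1 or f^-1 (g y)^-1 *)
exists q, (map t s); split; last by rewrite size_map ss.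
have tV g : (t g)^-1 = (g * y) * f^-1 * (g * y)^-1.
  by rewrite /t invgM invgK invgM mulgA.
have dir g h : g \in s -> h = f \/ h = f^-1 ->
    (len (g * y)).*2 <= gp (g * y) (g * y * h * (g * y)^-1) + K.
  move=> gs hf; have := HB g gs; have := gp_mull (g * y) (h * (g * y)^-1).
  rewrite mulgA.
  have : gp (f * (g * y)^-1) (g * y)^-1 <= Rf + (len g).*2 + (len g).*2.
    rewrite invgM mulgA.
    have := gp_mulr_le (f * y^-1) g^-1 (y^-1 * g^-1).
    have := gp_mulr_le y^-1 g^-1 (f * y^-1).
    move: yf; rewrite !(gpC (f * y^-1)) (lenV hypG); glia.
  have := gp_translate_le f^-1 (f * (g * y)^-1) (g * y)^-1.
  have := gpC (g * y)^-1 (f * (g * y)^-1).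
  rewrite mulKg (lenV hypG) /K.
  by case: hf => ->; glia.
have len_t g : g \in s -> q + K < (len (g * y)).*2 /\ q.*2 + (D.*2 + D.*2) < len (t g).
  move=> gs; have := HB g gs; have := dir g f gs (or_introl erefl).
  have := lenM hypG g^-1 (g * y); rewrite mulKg (lenV hypG) -/(t g).
  by have := gp_le_len (t g) (g * y); rewrite (gpC (t g)); glia.
rewrite /diverging pairwise_map; apply/andP; split; last first.
  by apply/allP => x /mapP[g gs ->]; have [_ ?] := len_t g gs.
have all_s : all (fun t => t \in s) s by apply/allP.
apply: (sub_in_pairwise _ all_s) ypw => g h gs hs ghR.
have sep k l : k = f \/ k = f^-1 -> l = f \/ l = f^-1 ->
    gp (g * y * k * (g * y)^-1) (h * y * l * (h * y)^-1) <= q.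
  move=> kf lf; rewrite leqNgt; apply/negP => gt_q.
  have [gl _] := len_t g gs; have [hl _] := len_t h hs.
  have := dir g k gs kf; have := dir h l hs lf.
  have := gp_four_point (g * y) (g * y * k * (g * y)^-1) (h * y * l * (h * y)^-1).
  have := gp_four_point (g * y) (h * y * l * (h * y)^-1) (h * y).
  by rewrite (gpC _ (h * y)); rewrite /q in gt_q gl hl *; glia.
by apply/andP; split; rewrite ?tV; apply: sep; auto.
Qed.

(** For a long u in N, all but at most two t in T are such that t^-1 points away
   from u and from u^-1; then t u t^-1 and its inverse start along t.  The bound q
   grows by a constant independent of N, which is what allows one choice of
   shadows to serve all N. *)
Lemma diverging_normal q L T N l : is_normal_subgroup N -> infinite_set N ->
  diverging q L T -> q + D.*2 < L -> 4 < size T ->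
  exists s, [/\ diverging (q + D.*2) l s, 2 < size s & forall x, x \in s -> N x].
Proof.
move=> [sN nN] infN dT qL szT.
have [B HB] := len_bounded T.
have [u Nu lu] := infinite_long (l + q + D.*2 + B.*2) infN.
have [] := diverging_count u dT; move=> _ c1.
have [] := diverging_count u^-1 dT; move=> _ c2.
pose P t := ~~ (q + D < gp u t^-1) && ~~ (q + D < gp u^-1 t^-1).
have szs : size T <= size [seq t <- T | P t] + 2 := size_filter2 c1 c2.
pose f t := t * u * t^-1.
have ft v t : (v = u) \/ (v = u^-1) -> t \in [seq t <- T | P t] ->
   (len t).*2 <= gp t (t * v * t^-1) + q + D.*2.
  move=> vu; rewrite mem_filter /P -!leqNgt => /andP[/andP[Pt1 Pt2] tT].
  have lv : len v = len u by case: vu => ->; rewrite ?(lenV hypG).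
  have Pv : gp v^-1 t^-1 <= q + D /\ gp v t^-1 <= q + D.
    by case: vu => ->; rewrite ?invgK.
  case: Pv => Pv1 Pv2.
  have := gp_mull t (v * t^-1); have := gp_mull v t^-1.
  have := gp_four_point v (v * t^-1) t^-1; rewrite (gpC _ t^-1) mulgA.
  glia.
have finv t : (f t)^-1 = t * u^-1 * t^-1 by rewrite /f !invgM invgK mulgA.
exists (map f [seq t <- T | P t]); split; last first.
- move=> _ /mapP[t _ ->]; have -> : f t = u ^ t^-1 by rewrite conjgE /f invgK mulgA.
  exact: nN.
- by rewrite size_map -(leq_add2r 2); apply: leq_trans szs.
case/andP: dT => pT /allP LT; apply/andP; split; last first.
  apply/allP => x /mapP[t]; rewrite mem_filter => /andP[_ tT] -> {x}.
  have := HB t tT; have := len_mul3 t^-1 (f t) t.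
  rewrite /f !mulgA mulVg mul1g mulgVK (lenV hypG) -!mulgA; glia.
rewrite pairwise_map.
have all_s : all (fun t => t \in [seq t <- T | P t]) [seq t <- T | P t].
  by apply/allP.
have := pairwise_filter P pT.
apply: (sub_in_pairwise _ all_s) => x y xs ys /andP[xy xy'].
have [xT yT] : L <= len x /\ L <= len y.
  by move: xs ys; rewrite !mem_filter => /andP[_ /LT ->] /andP[_ /LT ->].
have aux v v' : (v = u) \/ (v = u^-1) -> (v' = u) \/ (v' = u^-1) ->
    gp (x * v * x^-1) (y * v' * y^-1) <= q + D.*2.
  move=> hv hv'; rewrite leqNgt; apply/negP => h.
  have := ft v x hv xs; have := ft v' y hv' ys.
  have := gp_four_point x (x * v * x^-1) (y * v' * y^-1).
  have := gp_four_point x (y * v' * y^-1) y.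
  rewrite (gpC _ y). glia.
by apply/andP; split; rewrite ?finv; apply: aux; auto.
Qed.

(** The element n = x n0 y^-1, with n0 long in the coset c N, starts along x and
   n^-1 starts along y.  Each of x and y has to avoid two directions, so three
   candidates suffice.  A point z that starts along b does not start along n^-1;
   hence n z follows n ([gp_mull]), which does not start along a. *)
Lemma transversal_element q L s N c a b : is_normal_subgroup N ->
  infinite_set N -> (forall x, x \in s -> N x) -> diverging q L s ->
  q + D.*2 < L -> 2 < size s ->
  exists2 n, N (c^-1 * n) &
   forall y, gp b y <= q + (D.*2 + D) \/ gp a (n * y) <= q + (D.*2 + D).
Proof.
move=> [sN nN] infN sNs ds qL szs.
have [B HB] := len_bounded s.
have [u Nu lu] := infinite_long (q + D.*2 + D + B.*2 + len c) infN.
have ln0 : q + D.*2 + D + B.*2 < len (c * u).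
  have := lenM hypG c^-1 (c * u); rewrite mulKg (lenV hypG); glia.
have pick z v : exists x, [/\ x \in s, gp z x <= q + D & gp v x^-1 <= q + D].
  have [c1 _] := diverging_count z ds; have [_ c2] := diverging_count v ds.
  have := size_filter2 c1 c2.
  case E: [seq x <- s | _] => [|x s']; first by move/(leq_trans szs).
  have : x \in x :: s' by rewrite mem_head.
  by rewrite -E mem_filter -!leqNgt => /andP[/andP[? ?] ?]; exists x.
have [x [xs ax ux]] := pick a (c * u).
have [y [ys by_ uy]] := pick b (c * u)^-1.
have Lx z : z \in s -> L <= len z by case/andP: ds => _ /allP; apply.
have step d v e w : d \in s -> e \in s -> B.*2 + q + D.*2 < len v ->
    gp w d <= q + D -> gp v d^-1 <= q + D -> gp v^-1 e^-1 <= q + D ->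
    gp w (d * v * e^-1) <= q + D.*2.
  move=> /Lx ld es lv wd vd ve.
  have := gp_mull d (v * e^-1); have := gp_mull v e^-1.
  have := gp_four_point v (v * e^-1) d^-1; rewrite (gpC _ d^-1) mulgA.
  have := gp_four_point w (d * v * e^-1) d; rewrite (gpC _ d).
  glia.
exists (x * (c * u) * y^-1).
  have -> : c^-1 * (x * (c * u) * y^-1) = x ^ c * u * y^-1.
    by rewrite conjgE !mulgA.
  apply: (subgroupM sN); last by apply: (subgroupV sN); apply: sNs.
  by apply: (subgroupM sN) => //; apply: nN; apply: sNs.
move=> z; case: (leqP (gp b z) (q + (D.*2 + D))) => bz; first by left.
right; rewrite leqNgt; apply/negP => az.
have h1 := step x (c * u) y a xs ys.
have h2 := step y (c * u)^-1 x b ys xs.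
rewrite invgK (lenV hypG) in h2.
have {h1} h1 : gp a (x * (c * u) * y^-1) <= q + D.*2 by apply: h1 => //; glia.
have {h2} h2 : gp b (x * (c * u) * y^-1)^-1 <= q + D.*2.
  have -> : (x * (c * u) * y^-1)^-1 = y * (c * u)^-1 * x^-1.
    by rewrite [LHS]invgM invgK invgM mulgA.
  by apply: h2 => //; glia.
set n := x * (c * u) * y^-1 in h1 h2 az *.
have ln : len (c * u) <= len n + B.*2.
  have := len_mul3 x^-1 n y; have := HB x xs; have := HB y ys.
  rewrite /n !mulgA mulVg mul1g mulgVK (lenV hypG); glia.
have := gp_mull n z; have := gp_four_point a (n * z) n.
have := gp_four_point b z n^-1.
rewrite (gpC _ n) (gpC _ n^-1); glia.
Qed.

(** * Shadows *)

(** The y whose geodesic from 1 passes within about q / 2 of x. *)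
Definition shadow q x : set G := [set y | (len x).*2 <= gp x y + q].

(** All s in the family but at most one satisfy that w s continues w; two of
   them give disjoint subshadows. *)
Lemma shadow_split q L s w : diverging q L s -> q.*2 + (D.*2 + D.*2) < L ->
  2 < size s ->
  let r := q + D.*2 + (D.*2 + D) in
  exists x y, [/\ shadow r x `<=` shadow r w, shadow r y `<=` shadow r w,
    shadow r x `&` shadow r y = set0 & r < (len y).*2].
Proof.
move=> ds qL szs r.
have [c1 _] := diverging_count w^-1 ds.
have := count_predC (fun x => q + D < gp w^-1 x) s; rewrite -[count (predC _) s]size_filter.
case E: [seq x <- s | _] => [|x [|y s']]; do ?by move=> /= ?; lia.
move=> _.
have good z : z \in [:: x, y & s'] -> L <= len z /\ gp w^-1 z <= q + D.
  rewrite -E mem_filter /= -leqNgt => /andP[? zs]; split => //.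
  by case/andP: ds => _ /allP; apply.
have [Lx wx] : L <= len x /\ gp w^-1 x <= q + D by apply: good; rewrite !inE eqxx.
have [Ly wy] : L <= len y /\ gp w^-1 y <= q + D.
  by apply: good; rewrite !inE eqxx orbT.
have xy : gp x y <= q.
  case/andP: ds => + _ => /(pairwise_filter (predC (fun x => q + D < gp w^-1 x))).
  by rewrite E /= => /andP[/andP[/andP[]]].
have sub z : L <= len z -> gp w^-1 z <= q + D -> shadow r (w * z) `<=` shadow r w.
  move=> Lz wz v; rewrite /shadow /= /r => zv.
  have := len_mull w z; have := gp_mull w z; have := gp_four_point w (w * z) v.
  glia.
have lx := len_mull w x; have ly := len_mull w y.
exists (w * x), (w * y); split; [exact: sub|exact: sub| |rewrite /r; glia].
rewrite -subset0 => z [xz yz]; move: xz yz; rewrite /shadow /= /r => xz yz.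
have := gp_translate w x y; have := gp_four_point (w * x) z (w * y).
by rewrite (gpC z); glia.
Qed.

(** By [gp_mull], a z lies in the shadow of a exactly when z does not start along
   a^-1; so the condition on k = a n b^-1 is the conclusion of
   [transversal_element] for a^-1, b^-1 and n. *)
Lemma pingpong_element q L s N g a b : is_normal_subgroup N ->
  infinite_set N -> diverging q L s -> q + D.*2 < L -> 4 < size s ->
  let r := q + D.*2 + (D.*2 + D) in
  exists2 k, N (g^-1 * k) & forall x, ~ shadow r b x -> shadow r a (k * x).
Proof.
move=> nN infN ds qL szs r.
have [t [dt szt tN]] := diverging_normal (q + D.*2 + D.*2).+1 nN infN ds qL szs.
have [n Nn nP] := transversal_element (a^-1 * g * b) a^-1 b^-1 nN infN tN dt
  (leqnn _) szt.
exists (a * n * b^-1).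
  have -> : g^-1 * (a * n * b^-1) = ((a^-1 * g * b)^-1 * n) ^ b^-1.
    by rewrite conjgE !invgM !invgK !mulgA mulgV mul1g.
  by case: nN => _; apply.
move=> x bx; have [h|h] := nP (b^-1 * x).
  case: bx; rewrite /shadow /=.
  have := gp_mull b (b^-1 * x); rewrite mulVKg /r; glia.
rewrite /shadow /= -!mulgA.
by have := gp_mull a (n * (b^-1 * x)); rewrite /r; glia.
Qed.

(** Splitting repeatedly, one of the two subshadows is kept as the n-th member
   and the other one is split further. *)
Lemma disjoint_shadows q L s : diverging q L s -> q.*2 + (D.*2 + D.*2) < L ->
  2 < size s ->
  let r := q + D.*2 + (D.*2 + D) in
  exists a : nat -> G, (forall n, ~ shadow r (a n) 1) /\
    forall m n, m != n -> shadow r (a m) `&` shadow r (a n) = set0.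
Proof.
move=> ds qL szs r.
have /choice[f fP] := shadow_split _ ds qL szs.
have /choice[h hP] : forall w, exists y, [/\ shadow r (f w) `<=` shadow r w,
    shadow r y `<=` shadow r w, shadow r (f w) `&` shadow r y = set0 & r < (len y).*2].
  by move=> w; have [y] := fP w; exists y.
pose w n := iter n f 1.
have wS n m : n <= m -> shadow r (w m) `<=` shadow r (w n).
  elim: m => [|m IHm]; first by rewrite leqn0 => /eqP ->.
  rewrite leq_eqVlt => /orP[/eqP -> //|/IHm]; apply: subset_trans.
  by have [] := hP (w m).
have disj m n : m < n -> shadow r (h (w m)) `&` shadow r (h (w n)) = set0.
  move=> mn; rewrite -subset0 => x [hm hn].
  have [_ _ <- _] := hP (w m); split => //.
  by apply: (wS m.+1 n mn); have [_ + _ _] := hP (w n); apply.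
exists (h \o w); split=> [n|m n] /=.
  by have [_ _ _] := hP (w n); rewrite /shadow /= gp1; lia.
by case: ltngtP => // mn _; [|rewrite setIC]; apply: disj.
Qed.

End HyperbolicGroup.

(** * Prodense subgroups *)

Section Prodense.
Variables (G : groupType) (len : G -> nat) (D : nat).
Hypothesis hypG : hyperbolic_length len D.
Hypothesis infG : infinite_set [set: G].
Hypothesis nelG : ~ elementary G.

Lemma pingpong_exists : exists Z : bool -> nat -> set G,
  [/\ forall b c i j x, Z b i x -> Z c j x -> b = c /\ i = j,
      forall b i, ~ Z b i 1 &
      forall i N g, is_normal_subgroup N -> infinite_set N ->
        exists2 k, N (g^-1 * k) & forall x, ~ Z true i x -> Z false i (k * x)].
Proof.
have [q [s [ds szs]]] := diverging_exists hypG infG nelG.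
have szs2 : 2 < size s by apply: ltn_trans szs.
have [a [a1 aP]] := disjoint_shadows hypG ds (leqnn _) szs2.
(* even members of the sequence attract the k_i, odd ones their inverses *)
exists (fun b i => shadow len (q + D.*2 + (D.*2 + D)) (a (b + i.*2)%N)); split.
- move=> b c i j x bx cx; have [e|/eqP ne] := pselect (b + i.*2 = c + j.*2)%N.
    have := congr1 odd e; have := congr1 half e.
    by rewrite !oddD !odd_double !half_bit_double; case: (b) (c) => [] [].
  by have := aP _ _ ne; rewrite -subset0 => /(_ x)[].
- by move=> b i; apply: a1.
- move=> i N g nN infN; apply: (pingpong_element hypG g _ _ nN infN ds) => //; lia.
Qed.

Lemma infinite_order_element : exists k : G, injective (fun n => k ^+ n).
Proof.
have [Z [Zdisj Z1 Zk]] := pingpong_exists.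
have nT : is_normal_subgroup [set: G] by split=> //; apply: is_subgroupI.
have /choice[k kP] : forall i, exists k, forall x, ~ Z true i x -> Z false i (k * x).
  by move=> i; have [k _ kP] := Zk i [set: G] 1 nT infG; exists k.
by exists (k 0); apply: pingpong_infinite_order kP _.
Qed.

Lemma group_countable : countable [set: G].
Proof.
have /choice[s sP] := len_ball hypG.
have -> : [set: G] = \bigcup_(n in [set: nat]) [set` s n].
  by apply/esym/seteqP; split=> // x _; exists (len x) => //=; apply: sP.
by apply: bigcup_countable => // n _; apply: finite_set_countable.
Qed.

Lemma prodense_subgroup (F : set (set G)) : countable F ->
  (forall N, F N -> is_normal_subgroup N /\ infinite_set N) ->
  exists K : set G, [/\ is_subgroup K, infinitely_generated K &
    forall N, F N -> surjects_onto_quotient K N].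
Proof.
(* the whole group is adjoined so that there is at least one coset to list *)
move=> cF FN; pose F' := \bigcup_(b in [set: bool]) if b then F else [set [set: G]].
have F'N N : F' N -> is_normal_subgroup N /\ infinite_set N.
  by case=> -[] _ /= => [/FN //|->]; split=> //; split=> //; apply: is_subgroupI.
have cF' : countable (F' `*` [set: G]).
  by apply: countableX group_countable; apply: bigcup_countable => // -[].
have [c [cF'P c_surj]] : exists c : nat -> set G * G, (forall n, F' (c n).1) /\
    forall N g, F' N -> exists n, c n = (N, g).
  have [e|[c]] := pfcard_geP cF'.
    have : (F' `*` [set: G]) ([set: G], 1) by split=> //; exists false.
    by rewrite e.
  exists c; split=> [n|N g F'Ng].
    by have [] := @funS _ _ _ _ c n I.
  have [|n _ cn] := @surj _ _ _ _ c (N, g); first by split.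
  by exists n.
have [Z [Zdisj Z1 Zk]] := pingpong_exists.
have /choice[k kP] : forall i, exists k, (c i).1 ((c i).2^-1 * k) /\
    forall x, ~ Z true i x -> Z false i (k * x).
  move=> i; have [nN infN] := F'N _ (cF'P i).
  by have [k ? ?] := Zk i _ (c i).2 nN infN; exists k.
exists (generated (range k)); split; first exact: generated_subgroup.
- apply: infinitely_generated_range => n.
  by apply: (pingpong_free Zdisj Z1 (fun i => (kP i).2)); rewrite /= ltnn.
- move=> N FNN _ [g _ <-].
  have [n cn] : exists n, c n = (N, g) by apply: c_surj; exists true.
  exists (k n); first by apply: sub_generated; exists n.
  have [[sN _] _] := FN N FNN.
  apply/esym/(quotient_mapP _ _ sN).
  by have [+ _] := kP n; rewrite cn.
Qed.

End Prodense.

(** * Word length *)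

Section WordLength.
Variables (G : groupType) (S : set G).
Hypothesis finS : finite_set S.
Hypothesis genS : generated S = [set: G].

Lemma words_for_cat g h s t :
  words_for S g s -> words_for S h t -> words_for S (g * h) (s ++ t).
Proof.
move=> [sS sg] [tS th]; split; last by rewrite big_cat /= sg th.
by move=> a; rewrite mem_cat => /orP[/sS|/tS].
Qed.

Lemma words_forV g s : words_for S g s -> words_for S g^-1 (rev [seq a^-1 | a <- s]).
Proof.
move=> [sS sg]; split.
  move=> a; rewrite mem_rev => /mapP[c /sS cS ->]; rewrite invgK.
  by case: cS; [right|left].
rewrite -sg; elim: (s) => [|a w IHw] /=; first by rewrite !big_nil invg1.
by rewrite rev_cons -cats1 big_cat big_seq1 big_cons invgM /= IHw.
Qed.

Lemma words_for_exists g : exists s, words_for S g s.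
Proof.
have : [set: G] g by [].
rewrite -genS; move: g; apply: generated_sub.
  apply: is_subgroupI => [|x y [s sx] [t ty]|x [s sx]].
  - by exists nil; split=> //; rewrite big_nil.
  - by exists (s ++ t); apply: words_for_cat.
  - by exists (rev [seq a^-1 | a <- s]); apply: words_forV.
move=> g Sg; exists [:: g]; split; last by rewrite big_seq1.
by move=> a; rewrite inE => /eqP ->; left.
Qed.

(** Characterizes the word length as a minimum, attained by a geodesic word. *)
Definition shortest_word (len : G -> nat) := forall g,
  (exists2 s, words_for S g s & size s = len g) /\
  forall s, words_for S g s -> len g <= size s.

Lemma shortest_word_exists : exists len, shortest_word len.
Proof.
suff /choice[len lenP] : forall g, exists n,
    (exists2 s, words_for S g s & size s = n) /\
    forall s, words_for S g s -> n <= size s by exists len.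
move=> g.
have ex : exists n, `[< exists2 s, words_for S g s & size s = n >].
  by have [s sg] := words_for_exists g; exists (size s); apply/asboolP; exists s.
have [n /asboolP nP nmin] := ex_minnP ex; exists n; split=> // s sg.
by apply: nmin; apply/asboolP; exists s.
Qed.

Variable len : G -> nat.
Hypothesis lenP : shortest_word len.

Lemma len_le g s : words_for S g s -> len g <= size s.
Proof. by have [_] := lenP g; apply. Qed.

Lemma len_word1 : len 1 = 0.
Proof.
by apply/eqP; rewrite -leqn0; apply: (@len_le _ nil); split; rewrite ?big_nil.
Qed.

Lemma len_wordM x y : len (x * y) <= len x + len y.
Proof.
have [[s sx <-] _] := lenP x; have [[t ty <-] _] := lenP y.
by rewrite -size_cat; apply: len_le; apply: words_for_cat.
Qed.

Lemma len_wordV x : len x^-1 = len x.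
Proof.
have le y : len y^-1 <= len y.
  have [[s sy <-] _] := lenP y.
  by have := len_le (words_forV sy); rewrite size_rev size_map.
by apply/eqP; rewrite eqn_leq le -{1}[x]invgK le.
Qed.

Lemma len_word_ball n : exists s : seq G, forall x, len x <= n -> x \in s.
Proof.
have /finite_seqP[A SA] := finS.
have [s sP] : exists s : seq G, forall g w, words_for S g w -> size w <= n -> g \in s.
  elim: n => [|n [s sP]].
    by exists [:: 1] => g [|//] [_ <-] _; rewrite big_nil mem_head.
  exists (s ++ [seq a * x | a <- A ++ [seq a^-1 | a <- A], x <- s]).
  move=> g w [wS wg] wn; rewrite mem_cat; apply/orP.
  case: w => [|a w] in wS wg wn *; first by left; apply: (sP _ nil).
  right; apply/allpairsP; exists (a, \prod_(c <- w) c) => /=.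
  split; last by rewrite -wg big_cons.
    rewrite mem_cat; have [|] := wS a (mem_head _ _); rewrite SA /= => aA.
      by rewrite aA.
    by apply/orP; right; apply/mapP; exists a^-1; rewrite ?invgK.
  apply: (sP _ w) => //; split=> // c cw; apply: wS.
  by rewrite inE cw orbT.
exists s => x xn; have [[w wx wl] _] := lenP x.
by apply: (sP x w) => //; rewrite wl.
Qed.

(** Both parts of a shortest word are shortest, by the triangle inequality. *)
Lemma len_word_prefix x n : n <= len x ->
  exists2 p, len p = n & len (p^-1 * x) = len x - n.
Proof.
have [[w [wS wx] wl] _] := lenP x => nx.
pose p := \prod_(a <- take n w) a; pose r := \prod_(a <- drop n w) a.
have pr : x = p * r by rewrite -wx -{1}(cat_take_drop n w) big_cat.
have lp : len p <= n.
  have -> : n = size (take n w) by rewrite size_take wl; case: ltngtP nx.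
  by apply: len_le; split=> // a /mem_take; apply: wS.
have lr : len r <= len x - n.
  rewrite -wl -size_drop.
  by apply: len_le; split=> // a /mem_drop; apply: wS.
have := len_wordM p r; rewrite -pr => lx.
by exists p; rewrite ?pr ?mulKg; rewrite -?pr; lia.
Qed.

Import Order.TTheory GRing.Theory Num.Theory.

Variable R : realType.

Lemma word_lengthE g : word_length R S g = (len g)%:R%R.
Proof.
have [[s sg sl] _] := lenP g.
rewrite /word_length; apply/le_anti/andP; split.
  apply: ge_inf; last by exists s => //; rewrite sl.
  by exists 0%R => _ [t _ <-]; rewrite ler0n.
apply: lb_le_inf; first by exists (size s)%:R%R; exists s.
by move=> _ [t tg <-]; rewrite ler_nat; apply: len_le.
Qed.

Lemma word_hyperbolic_length (delta : R) : (0 <= delta)%R ->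
  delta_hyperbolic (word_metric R S) delta ->
  exists D, hyperbolic_length len D.
Proof.
move=> delta_ge0 hyp; pose D := Num.bound (delta *+ 2)%R.
exists D; split; [exact: len_word1|exact: len_wordV|exact: len_wordM
  |exact: len_word_ball|exact: len_word_prefix|move=> x y z].
have lenB u v : (((len u + len v - len (u^-1 * v))%N)%:R =
    gromov_product (word_metric R S) 1%g u v *+ 2 :> R)%R.
  rewrite /gromov_product /word_metric !word_lengthE !mulg1 !len_wordV.
  rewrite natrB ?natrD; last by have := len_wordM u^-1 v; rewrite len_wordV.
  by rewrite -[RHS]mulr_natr divfK // pnatr_eq0.
have Dle : (delta *+ 2 <= D%:R)%R by apply/ltW/archi_boundP; rewrite mulrn_wge0.
have := hyp 1 x y z; rewrite lerBlDr ge_min geq_min.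
case/orP => xyz; apply/orP; [left|right];
  by rewrite -(ler_nat R) natrD !lenB; lra.
Qed.

End WordLength.

Local Close Scope group_scope.

(** * Surjections onto quotients and engulfing *)
Theorem theorem6p1 (R : realType) (G : groupType)
    (G_hyperbolic : word_hyperbolic R G) (G_nonelementary : ~ elementary G) :
  (forall F : set (set G),
     countable F ->
     (forall N : set G, F N -> is_normal_subgroup N /\ infinite_set N) ->
     exists K : set G,
       [/\ is_proper_subgroup K, infinitely_generated K &
         forall N : set G, F N -> surjects_onto_quotient K N]) /\
  (exists K : set G, is_proper_subgroup K /\ ~ engulfed K).
Proof.
have [S [finS genS [delta delta_ge0 hyp]]] := G_hyperbolic.
have [len lenP] := shortest_word_exists genS.
have [D hypG] := word_hyperbolic_length finS lenP delta_ge0 hyp.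
have infG : infinite_set [set: G] by move=> finG; apply: G_nonelementary; left.
have proper K : infinitely_generated K -> K <> [set: G].
  by move=> + KT; rewrite KT; apply; exists S.
split=> [F cF FN|].
  have [K [sK iK KN]] := prodense_subgroup hypG infG G_nonelementary cF FN.
  by exists K; split=> //; split=> //; apply: proper.
pose P n : set G := generated [set x ^+ n.+1 | x in [set: G]]%g.
have [k kI] := infinite_order_element hypG infG G_nonelementary.
have [K [sK iK KN]] : exists K : set G, [/\ is_subgroup K, infinitely_generated K &
    forall N, range P N -> surjects_onto_quotient K N].
  apply: (prodense_subgroup hypG infG G_nonelementary).
    exact: sub_countable (card_image_le _ _) (countableP _).
  move=> _ [n _ <-]; split; first exact: power_subgroup_normal.
  apply: (@sub_infinite_set _ (range (fun m => (k ^+ m) ^+ n.+1)%g)).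
    by move=> _ [m _ <-]; apply: sub_generated; exists (k ^+ m)%g.
  apply: infinite_range => m m' /=; rewrite -!expgnA => /kI /eqP.
  by rewrite eqn_pmul2r // => /eqP.
exists K; split; first by split=> //; apply: proper.
case=> L [[sL LT] finL KL]; apply: LT; apply/seteqP; split=> // x _.
have [[//|n] _ Ln] := finite_index_exponent sL finL.
have [|y Ky] := KN (P n) (ex_intro2 _ _ n I erefl) (quotient_map (P n) x).
  by exists x.
move/(quotient_mapP _ _ (@generated_subgroup G _)) => yx.
rewrite -[x](mulVKg y); apply: (subgroupM sL); first exact: KL.
by apply: (generated_sub sL _ yx) => _ [z _ <-]; apply: Ln.
Qed.
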